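(* Suppose that for every $p\in\mathcal N$ the regularizer $\vartheta^p:\mathbb R^{n_p}\to\mathbb R\cup\{\infty\}$ is steep and induces a $\mathcal C^1$ mirror map $C^p_\epsilon=\nabla{\psi^p_\epsilon}^\star$, where $\psi^p_\epsilon=\epsilon\vartheta^p$. Let $\gamma>0$ and $\alpha,\beta\ge0$. Then the primal-space system of differential inclusions $$\dot\xi^p\in\beta(x^p-\xi^p),\qquad \dot x^p\in\gamma\,\nabla^2{\psi^p_\epsilon}^\star(z^p)\big(U^p(x)-\alpha(x^p-\xi^p)\big),\qquad z^p\in(C^p_\epsilon)^{-1}(x^p),$$ reduces to the system of ordinary differential equations $$\dot\xi^p=\beta(x^p-\xi^p),\qquad \dot x^p=\gamma\,\nabla^2{\psi^p_\epsilon}^\star\big(\nabla\psi^p_\epsilon(x^p)\big)\big(U^p(x)-\alpha(x^p-\xi^p)\big).$$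
   Context: **Game.** $\mathcal N=\{1,\dots,N\}$ is the set of players; player $p$ has a non-empty, closed, convex strategy set $\Omega^p\subseteq\mathbb R^{n_p}$ and payoff $\mathcal U^p:\Omega\to\mathbb R$, where $\Omega=\prod_p\Omega^p$; each $\mathcal U^p$ is jointly continuous, concave and continuously differentiable in $x^p$ for all $x^{-p}$, and is implicitly assumed defined and continuously differentiable on an open set containing $\Omega$. The partial gradient is $U^p(x)=\nabla_{x^p}\mathcal U^p(x^p;x^{-p})$. **Regularizer and mirror map.** $\vartheta^p:\mathbb R^{n_p}\to\mathbb R\cup\{\infty\}$ is closed, proper and at least strictly convex, with $\mathrm{dom}(\vartheta^p)=\Omega^p$. *Steep* means $\|\nabla\vartheta^p(x_k)\|_\star\to\infty$ (dual norm) whenever $(x_k)$ is a sequence in $\mathrm{rint}(\Omega^p)$ converging to a point of the (relative) boundary. For $\epsilon>0$, $C^p_\epsilon(z^p)=\mathrm{argmax}_{y^p\in\Omega^p}[{y^p}^\top z^p-\epsilon\vartheta^p(y^p)]$, and ${\psi^p_\epsilon}^\star$ is the convex conjugate of $\psi^p_\epsilon$. The inverse (pre-image) of $C^p_\epsilon$ is $(C^p_\epsilon)^{-1}=\partial\psi^p_\epsilon$. Since $\vartheta^p$ is steep, $C^p_\epsilon$ takes values in $\mathrm{rint}(\Omega^p)$, and $x^p$ ranges over $\mathrm{rint}(\Omega^p)$. For $x^p$ there, $\partial\psi^p_\epsilon(x^p)=\{\nabla\psi^p_\epsilon(x^p)\}+N_{\Omega^p}(x^p)$, where $N_{\Omega^p}(x^p)=\{v:\,v^\top(y-x^p)\le0\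 \forall y\in\Omega^p\}$ and $\nabla\psi^p_\epsilon(x^p)$ denotes the gradient of (the expression defining) $\psi^p_\epsilon$, assumed to be defined and differentiable on an open set containing $\mathrm{rint}(\Omega^p)$ when $\Omega^p$ has empty interior. **Meaning of the inclusions.** The inclusions arise by differentiating $x=C_\epsilon(z)$ in time along the dynamics $\dot z^p=\gamma(U^p(x)-\alpha(x^p-\xi^p))$, $\dot\xi^p=\beta(x^p-\xi^p)$, $x^p=C^p_\epsilon(z^p)$; the right-hand side is a set because $z^p$ may be any element of $(C^p_\epsilon)^{-1}(x^p)$. ''Reduces to'' means that the set-valued right-hand side is the singleton given by the ODE. *)

(* Defs.v *)
From HB Require Import structures.
From mathcomp Require Import all_boot all_order all_algebra.
From mathcomp Require Import all_classical all_reals all_analysis.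
Set Implicit Arguments.
Unset Strict Implicit.
Unset Printing Implicit Defensive.
Import Order.TTheory GRing.Theory Num.Theory.
Import numFieldNormedType.Exports.
Local Open Scope classical_set_scope.
Local Open Scope ring_scope.

Definition dot (R : realType) n (u v : 'cV[R]_n) : R := \sum_i u i 0 * v i 0.

Definition dual_norm (R : realType) n (v : 'cV[R]_n) : R :=
  sup [set dot y v | y in [set y : 'cV[R]_n | `|y| <= 1]].

Definition gradient (R : realType) n (f : 'cV[R]_n -> R) (x : 'cV[R]_n)
    : 'cV[R]_n :=
  \col_i 'D_(delta_mx i 0) f x.

Definition hessian (R : realType) n (f : 'cV[R]_n -> R) (x : 'cV[R]_n)
    : 'M[R]_n :=
  \matrix_(i, j) 'D_(delta_mx j 0) (fun y => gradient f y i 0) x.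

(* Pointwise continuity of the derivative; all uses are finite-dimensional,
   where this is the same as continuity in operator norm. *)
Definition C1_on (R : realType) (V W : normedModType R) (A : set V)
    (f : V -> W) : Prop :=
  forall x, A x ->
    differentiable f x /\
    forall v, {for x, continuous (fun y => 'd f y v : W)}.

Definition C1_around (R : realType) (V W : normedModType R) (A : set V)
    (f : V -> W) : Prop :=
  exists2 O : set V, open O /\ A `<=` O & C1_on O f.

Definition affine_set (R : realType) n (A : set 'cV[R]_n) : Prop :=
  forall x y (t : R), A x -> A y -> A ((1 - t) *: x + t *: y).

Definition affine_hull (R : realType) n (A : set 'cV[R]_n) : set 'cV[R]_n :=
  smallest (@affine_set R n) A.

Definition rint (R : realType) n (A : set 'cV[R]_n) : set 'cV[R]_n :=
  [set x | A x /\ exists2 r : R, 0 < r & ball x r `&` affine_hull A `<=` A].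

Definition rboundary (R : realType) n (A : set 'cV[R]_n) : set 'cV[R]_n :=
  closure A `\` rint A.

Definition conjugate (R : realType) n (f : 'cV[R]_n -> \bar R)
    (z : 'cV[R]_n) : \bar R :=
  ereal_sup (range (fun y => (dot y z)%:E - f y)%E).

Record is_regularizer (R : realType) n (Omega : set 'cV[R]_n)
    (theta : 'cV[R]_n -> \bar R) : Prop := IsRegularizer {
  reg_gtNy : forall x, (-oo < theta x)%E;
  reg_proper : exists x, (theta x < +oo)%E;
  reg_closed : lower_semicontinuous theta;
  reg_dom : [set x | (theta x < +oo)%E] = Omega;
  reg_strict_convex : forall x y (t : R), Omega x -> Omega y -> x != y ->
    0 < t < 1 ->
    (theta (t *: x + (1 - t) *: y)%R <
     t%:E * theta x + (1 - t)%:E * theta y)%E }.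

(* [g] is a real-valued expression for [theta], differentiable on a
   neighbourhood of rint Omega; gradients of [theta] on rint Omega are those of
   [g].  When Omega has nonempty interior, they do not depend on [g] and are
   the ordinary gradients of [theta]; otherwise [g] fixes the component normal
   to the affine hull of Omega. *)
Definition differentiable_expression (R : realType) n (Omega : set 'cV[R]_n)
    (theta : 'cV[R]_n -> \bar R) (g : 'cV[R]_n -> R) : Prop :=
  (exists2 O : set 'cV[R]_n, open O /\ rint Omega `<=` O &
     forall x, O x -> differentiable g x) /\
  (forall x, rint Omega x -> theta x = (g x)%:E).

(* The property does not depend on the norm whose dual is taken. *)
Definition steep (R : realType) n (Omega : set 'cV[R]_n)
    (g : 'cV[R]_n -> R) : Prop :=
  forall (u : nat -> 'cV[R]_n) (l : 'cV[R]_n),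
    (forall k, rint Omega (u k)) -> u @ \oo --> l -> rboundary Omega l ->
    (fun k => dual_norm (gradient g (u k))) @ \oo --> +oo.

Section MirrorMap.
Context (R : realType) (n : nat).
Implicit Types (Omega : set 'cV[R]_n) (theta : 'cV[R]_n -> \bar R) (eps : R).

Definition psi eps theta : 'cV[R]_n -> \bar R := fun y => (eps%:E * theta y)%E.

(* Real-valued version of the conjugate, which is finite everywhere as soon as
   the maximum defining the mirror map is attained. *)
Definition psi_star eps theta (z : 'cV[R]_n) : R :=
  fine (conjugate (psi eps theta) z).

Definition mirror_argmax Omega eps theta (z : 'cV[R]_n) : set 'cV[R]_n :=
  [set y | Omega y /\ forall y', Omega y' ->
     ((dot y' z)%:E - psi eps theta y' <= (dot y z)%:E - psi eps theta y)%E].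

Definition C1_mirror_map Omega eps theta (C : 'cV[R]_n -> 'cV[R]_n) : Prop :=
  [/\ forall z, mirror_argmax Omega eps theta z = [set C z],
      forall z, differentiable (psi_star eps theta) z /\
                C z = gradient (psi_star eps theta) z
    & C1_on setT C].

End MirrorMap.

Section Game.
Context (R : realType) (N : nat) (n : 'I_N -> nat).

(* A strategy profile is the block column vector of the players' strategies. *)
Local Notation profile := 'cV[R]_(\sum_p n p).

Definition profiles (Omega : forall p, set 'cV[R]_(n p)) : set profile :=
  [set x | forall p, Omega p (submxcol x p)].

(* The profile (y; x^{-p}). *)
Definition deviate (x : profile) (p : 'I_N) (y : 'cV[R]_(n p)) : profile :=
  \mxcol_q dfwith (fun q => submxcol x q) p y q.

(* Payoffs are total functions; only their values around [profiles Omega] are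
   constrained. *)
Record is_game (Omega : forall p, set 'cV[R]_(n p))
    (payoff : 'I_N -> profile -> R) : Prop := IsGame {
  game_nonempty : forall p, Omega p !=set0;
  game_closed : forall p, closed (Omega p);
  game_convex : forall p, convex_set (Omega p);
  game_continuous : forall p, {within profiles Omega, continuous (payoff p)};
  game_concave : forall p x, profiles Omega x ->
    convex_function (Omega p) (fun y => - payoff p (deviate x y) : R^o);
  game_C1_partial : forall p x, profiles Omega x ->
    C1_around (Omega p) (fun y => payoff p (deviate x y));
  game_C1 : forall p, C1_around (profiles Omega) (payoff p) }.

Definition partial_gradient (payoff : 'I_N -> profile -> R) (p : 'I_N)
    (x : profile) : 'cV[R]_(n p) :=
  gradient (fun y => payoff p (deviate x y)) (submxcol x p).

Definition drift (payoff : 'I_N -> profile -> R) (alpha : R) (x xi : profile)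
    (p : 'I_N) : 'cV[R]_(n p) :=
  partial_gradient payoff p x - alpha *: (submxcol x p - submxcol xi p).

(* The right-hand sides are the sets of admissible velocities, resp. the
   velocity, as pairs (xi', x'). *)
Definition primal_inclusion (payoff : 'I_N -> profile -> R)
    (theta : forall p, 'cV[R]_(n p) -> \bar R)
    (C : forall p, 'cV[R]_(n p) -> 'cV[R]_(n p))
    (eps alpha beta gamma : R) (x xi : profile) : set (profile * profile) :=
  [set w | forall p,
     [set beta *: (submxcol x p - submxcol xi p)] (submxcol w.1 p) /\
     [set gamma *: (hessian (psi_star eps (@theta p)) z *m
                    drift payoff alpha x xi p)
        | z in @C p @^-1` [set submxcol x p]] (submxcol w.2 p)].

Definition primal_ode (payoff : 'I_N -> profile -> R)
    (theta : forall p, 'cV[R]_(n p) -> \bar R)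
    (g : forall p, 'cV[R]_(n p) -> R)
    (eps alpha beta gamma : R) (x xi : profile) : profile * profile :=
  (\mxcol_p (beta *: (submxcol x p - submxcol xi p)),
   \mxcol_p (gamma *: (hessian (psi_star eps (@theta p))
                         (gradient (fun y => eps * @g p y) (submxcol x p)) *m
                       drift payoff alpha x xi p))).

End Game.

(* Main.v *)
Require Import Defs.
From HB Require Import structures.
From mathcomp Require Import all_boot all_order all_algebra.
From mathcomp Require Import all_classical all_reals all_analysis.
From mathcomp Require Import lra.
Set Implicit Arguments.
Unset Strict Implicit.
Unset Printing Implicit Defensive.
Import Order.TTheory GRing.Theory Num.Theory.
Import numFieldNormedType.Exports.
Local Open Scope classical_set_scope.
Local Open Scope ring_scope.

(** Write f = eps * g and z0 for the gradient of f at x^p, a relative interior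
    point of the strategy set Omega.  The fibre of the mirror map C over x^p is
    z0 plus a set of vectors normal to Omega, and adding such a vector never
    changes C; since the Hessian of the conjugate is the derivative of C, it is
    constant on the fibre.  In detail:
    - the fibre is nonempty, as it contains z0: by convexity of theta, the
      one-sided derivatives of f at x^p give a subgradient inequality, which
      says that x^p solves the maximization defining C z0
      ([gradient_subgradient], [mirror_map_gradient]);
    - if C z = x^p, the first-order condition holds in both directions along
      every segment from x^p to a point y of Omega, because such segments
      extend slightly beyond x^p inside Omega; so w = z - z0 is orthogonal to
      y - x^p for all y in Omega ([subgradient_tangent]);
    - the linear form given by w is therefore constant on Omega, and adding w
      to any dual vector shifts the objective of the maximization by a constant
      ([mirror_argmaxD]); hence C (u + w) = C u for all u, and the Hessians at z
      and z0 agree ([hessian_fiber]). *)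

Lemma dotBl (R : realType) n (u v w : 'cV[R]_n) :
  dot (u - v) w = dot u w - dot v w.
Proof. by rewrite /dot -sumrB; apply: eq_bigr => i _; rewrite !mxE mulrBl. Qed.

Lemma dotDr (R : realType) n (u v w : 'cV[R]_n) :
  dot u (v + w) = dot u v + dot u w.
Proof. by rewrite /dot -big_split; apply: eq_bigr => i _; rewrite !mxE mulrDr. Qed.

Lemma dotBr (R : realType) n (u v w : 'cV[R]_n) :
  dot u (v - w) = dot u v - dot u w.
Proof. by rewrite /dot -sumrB; apply: eq_bigr => i _; rewrite !mxE mulrBr. Qed.

Lemma dotZl (R : realType) n t (u v : 'cV[R]_n) :
  dot (t *: u) v = t * dot u v.
Proof. by rewrite /dot mulr_sumr; apply: eq_bigr => i _; rewrite !mxE mulrA. Qed.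

Lemma derive_gradient (R : realType) n (f : 'cV[R]_n -> R) (x v : 'cV[R]_n) :
  differentiable f x -> 'D_v f x = dot v (gradient f x).
Proof.
move=> df; rewrite deriveE// {1}[v]matrix_sum_delta linear_sum /dot.
apply: eq_bigr => i _.
by rewrite big_ord1 linearZ mxE deriveE.
Qed.

Lemma near0_right (R : realType) (P : set R) :
  (\forall t \near (0 : R), P t) -> \forall t \near (0 : R)^'+, P t.
Proof. exact: cvg_within. Qed.

Lemma derive_le (R : realType) (V : normedModType R) (f : V -> R) (x v : V)
    (c : R) :
  differentiable f x ->
  (\forall t \near (0 : R)^'+, f (x + t *: v) - f x <= t * c) ->
  'D_v f x <= c.
Proof.
move=> df le_f; have /cvg_dnbhs_at_right cvgD := @diff_derivable _ _ _ f x v df.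
apply: (cvgr_to_le cvgD); near=> t.
have t0 : 0 < t by near: t; exact: nbhs_right_gt.
rewrite /= [t *: v + x]addrC -[_ *: _]/(_ * _) ler_pdivrMl//.
by near: t.
Unshelve. all: by end_near. Qed.

(** A function which stays above the affine function of slope c through its
    value at x, near x and on both sides of it along v, has derivative c there. *)
Lemma derive_eq (R : realType) (V : normedModType R) (f : V -> R) (x v : V)
    (c : R) :
  differentiable f x ->
  (\forall t \near (0 : R), t * c <= f (x + t *: v) - f x) ->
  'D_v f x = c.
Proof.
move=> df ge_f.
have dNf : differentiable (- f) x by exact: differentiableN.
have ge_fN : \forall t \near (0 : R), - t * c <= f (x + - t *: v) - f x.
  have : (fun t : R => - t) @ (0 : R) --> (0 : R).
    by rewrite -[X in _ --> X](oppr0 R); exact: opp_continuous.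
  by move/(_ _ ge_f).
apply/eqP; rewrite eq_le; apply/andP; split.
  (* the upper bound is [derive_le] for - f in the direction - v *)
- rewrite (_ : 'D_v f x = 'D_(- v) (- f) x); last first.
    rewrite !deriveE// diffN// [RHS](_ : _ = - ('d f x (- v)))//.
    by rewrite linearN opprK.
  apply: derive_le => //; move/near0_right: ge_fN; apply: filterS => t.
  by rewrite /= !fctE scalerN -scaleNr; lra.
- rewrite -lerN2 (_ : - 'D_v f x = 'D_v (- f) x); last first.
    by rewrite !deriveE// diffN.
  apply: derive_le => //; move/near0_right: ge_f; apply: filterS => t.
  by rewrite /= !fctE; lra.
Qed.

(** The line from a relative interior point x through a point y of A stays in
    the relative interior near x, on both sides of x. *)
Lemma rint_near (R : realType) n (A : set 'cV[R]_n) (x y : 'cV[R]_n) :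
  rint A x -> A y -> \forall t \near (0 : R), rint A (x + t *: (y - x)).
Proof.
move=> [Ax [r r0 sA]] Ay.
have aff t : affine_hull A (x + t *: (y - x)).
  move=> B [affB AB]; rewrite (_ : _ + _ = (1 - t) *: x + t *: y).
    by apply: affB; exact: AB.
  by rewrite scalerBr scalerBl scale1r addrA addrAC.
have r20 : 0 < r / 2 by rewrite divr_gt0.
have cvgx : (fun t : R => x + t *: (y - x)) @ (0 : R) --> x + 0 *: (y - x).
  by apply: cvgD; [exact: cvg_cst|apply: cvgZr_tmp; exact: cvg_id].
rewrite scale0r addr0 in cvgx.
have : \forall t \near (0 : R), ball x (r / 2) (x + t *: (y - x)).
  exact: cvgx (nbhsx_ballx x _ r20).
apply: filterS => t xt.
have sub : ball (x + t *: (y - x)) (r / 2) `<=` ball x r.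
  by move=> u ut; rewrite [r]splitr; exact: ball_triangle xt ut.
split.
  by apply: sA; split => //; apply: sub; exact: ballxx.
by exists (r / 2) => // u [ut uA]; apply: sA; split => //; exact: sub.
Qed.

Lemma regularizer_fin_num (R : realType) n (Omega : set 'cV[R]_n) theta x :
  is_regularizer Omega theta -> Omega x -> theta x \is a fin_num.
Proof.
move=> reg; rewrite -(reg_dom reg) /= => xy.
by rewrite fin_real// (reg_gtNy reg) xy.
Qed.

Lemma fine_psi (R : realType) n (Omega : set 'cV[R]_n) eps theta x :
  is_regularizer Omega theta -> Omega x ->
  psi eps theta x = (eps * fine (theta x))%:E.
Proof.
by move=> reg Ox; rewrite /psi EFinM fineK// (regularizer_fin_num reg).
Qed.

(** Convexity of theta, as a bound on its increments by those of the chord. *)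
Lemma regularizer_chord (R : realType) n (Omega : set 'cV[R]_n) theta x y t :
  is_regularizer Omega theta -> Omega x -> Omega y -> 0 < t < 1 ->
  Omega (x + t *: (y - x)) ->
  fine (theta (x + t *: (y - x))) - fine (theta x) <=
    t * (fine (theta y) - fine (theta x)).
Proof.
move=> reg Ox Oy t01 Oxy.
have [<-|nxy] := eqVneq y x; first by rewrite !subrr scaler0 addr0 subrr mulr0.
have := reg_strict_convex reg Oy Ox nxy t01.
rewrite (_ : t *: y + _ = x + t *: (y - x)); last first.
  by rewrite scalerBr scalerBl scale1r addrC -addrA [- _ + _]addrC.
rewrite -(fineK (regularizer_fin_num reg Ox)) -(fineK (regularizer_fin_num reg Oy)).
rewrite -(fineK (regularizer_fin_num reg Oxy)) -!EFinM -EFinD lte_fin /=.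
by lra.
Qed.

(** The argmax at z contains x exactly when z is a subgradient of
    eps * theta at x. *)
Lemma mirror_argmaxE (R : realType) n (Omega : set 'cV[R]_n) eps theta z x :
  is_regularizer Omega theta ->
  mirror_argmax Omega eps theta z x <->
  Omega x /\ forall y, Omega y ->
    dot (y - x) z <= eps * fine (theta y) - eps * fine (theta x).
Proof.
move=> reg; split=> -[Ox H]; split=> // y Oy; have := H y Oy.
  rewrite (fine_psi eps reg Ox) (fine_psi eps reg Oy).
  by rewrite -!EFinB lee_fin dotBl; lra.
rewrite (fine_psi eps reg Ox) (fine_psi eps reg Oy).
by rewrite -!EFinB lee_fin dotBl; lra.
Qed.

Lemma gradient_subgradient (R : realType) n (Omega : set 'cV[R]_n) eps theta g x :
  0 < eps -> is_regularizer Omega theta ->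
  differentiable_expression Omega theta g -> rint Omega x ->
  mirror_argmax Omega eps theta (gradient (fun y => eps * g y) x) x.
Proof.
move=> eps0 reg [[W [_ rW] dg] gE] rx; have [Ox _] := rx.
have df : differentiable (fun y => eps * g y) x.
  by apply: differentiableM => //; exact/dg/rW.
apply/mirror_argmaxE => //; split=> // y Oy.
rewrite -derive_gradient//; apply: derive_le => //.
near=> t.
have t01 : 0 < t < 1.
  by apply/andP; split; near: t; [exact: nbhs_right_gt|exact: nbhs_right_lt].
have rt : rint Omega (x + t *: (y - x)).
  by near: t; apply: near0_right; exact: rint_near.
have := regularizer_chord reg Ox Oy t01 rt.1.
rewrite (gE _ rt) (gE _ rx) /= -!mulrBr mulrCA.
by rewrite ler_pM2l.
Unshelve. all: by end_near. Qed.

Lemma subgradient_tangent (R : realType) n (Omega : set 'cV[R]_n) eps theta g x y z :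
  is_regularizer Omega theta ->
  differentiable_expression Omega theta g -> rint Omega x -> Omega y ->
  mirror_argmax Omega eps theta z x ->
  dot (y - x) (gradient (fun y => eps * g y) x) = dot (y - x) z.
Proof.
move=> reg [[W [_ rW] dg] gE] rx Oy /(mirror_argmaxE _ _ _ reg)[_ zx].
have df : differentiable (fun y => eps * g y) x.
  by apply: differentiableM => //; exact/dg/rW.
rewrite -derive_gradient//; apply: derive_eq => //.
have := rint_near rx Oy; apply: filterS => t rt.
have := zx _ rt.1; rewrite (gE _ rt) (gE _ rx) /=.
by rewrite [x + _]addrC addrK dotZl.
Qed.

(** Vectors orthogonal to Omega - x are invisible to the maximization. *)
Lemma mirror_argmaxD (R : realType) n (Omega : set 'cV[R]_n) eps theta x w z :
  is_regularizer Omega theta ->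
  (forall y, Omega y -> dot (y - x) w = 0) ->
  mirror_argmax Omega eps theta (z + w) = mirror_argmax Omega eps theta z.
Proof.
move=> reg w0; apply/seteqP; split=> y;
  move=> /(mirror_argmaxE _ _ _ reg)[Oy H];
  apply/mirror_argmaxE => //; split=> // u Ou; have := H u Ou;
  have := w0 _ Ou; have := w0 _ Oy; rewrite !dotBl !dotDr; lra.
Qed.

Lemma derive_shift (R : realType) (V W : normedModType R) (f : V -> W)
    (x w v : V) :
  (forall y, f (y + w) = f y) -> 'D_v f (x + w) = 'D_v f x.
Proof.
move=> fw; rewrite /derive fw (_ : f \o shift (x + w) = f \o shift x)//.
by apply/funext => h /=; rewrite addrA fw.
Qed.

(** The Hessian of the conjugate takes the same value at all points of the fibre
    of the mirror map over a relative interior point. *)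
Lemma hessian_fiber (R : realType) n (Omega : set 'cV[R]_n) eps theta g C x z :
  0 < eps -> is_regularizer Omega theta ->
  differentiable_expression Omega theta g ->
  C1_mirror_map Omega eps theta C -> rint Omega x -> C z = x ->
  hessian (psi_star eps theta) z =
  hessian (psi_star eps theta) (gradient (fun y => eps * g y) x).
Proof.
move=> eps0 reg gP [Cmax CE _] rx Cz.
set z0 := gradient _ x.
have zx : mirror_argmax Omega eps theta z x by rewrite Cmax -Cz.
have w0 y : Omega y -> dot (y - x) (z - z0) = 0.
  move=> Oy; rewrite dotBr.
  by rewrite (subgradient_tangent reg gP rx Oy zx) subrr.
have Cw u : C (u + (z - z0)) = C u.
  have : [set C (u + (z - z0))] (C (u + (z - z0))) by [].
  by rewrite -Cmax (mirror_argmaxD _ _ reg w0) Cmax.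
apply/matrixP => i j; rewrite !mxE -[in LHS](subrKC z0 z).
by apply: derive_shift => y; rewrite -!(CE _).2 Cw.
Qed.

Lemma mirror_map_gradient (R : realType) n (Omega : set 'cV[R]_n) eps theta g C x :
  0 < eps -> is_regularizer Omega theta ->
  differentiable_expression Omega theta g ->
  C1_mirror_map Omega eps theta C -> rint Omega x ->
  C (gradient (fun y => eps * g y) x) = x.
Proof.
move=> eps0 reg gP [Cmax _ _] rx.
by have := gradient_subgradient eps0 reg gP rx; rewrite Cmax.
Qed.

Unset Implicit Arguments.
Set Strict Implicit.

Theorem proposition2 (R : realType) (N : nat) (n : 'I_N -> nat)
  (Omega : forall p : 'I_N, set 'cV[R]_(n p))
  (payoff : 'I_N -> 'cV[R]_(\sum_p n p) -> R)
  (theta : forall p : 'I_N, 'cV[R]_(n p) -> \bar R)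
  (g : forall p : 'I_N, 'cV[R]_(n p) -> R)
  (C : forall p : 'I_N, 'cV[R]_(n p) -> 'cV[R]_(n p))
  (eps alpha beta gamma : R)
  (hgame : is_game Omega payoff)
  (heps : 0 < eps)
  (hreg : forall p, is_regularizer (Omega p) (theta p))
  (hg : forall p, differentiable_expression (Omega p) (theta p) (g p))
  (hsteep : forall p, steep (Omega p) (g p))
  (hC : forall p, C1_mirror_map (Omega p) eps (theta p) (C p))
  (hgamma : 0 < gamma) (halpha : 0 <= alpha) (hbeta : 0 <= beta) :
  forall x xi : 'cV[R]_(\sum_p n p),
    (forall p, rint (Omega p) (submxcol x p)) ->
    primal_inclusion payoff theta C eps alpha beta gamma x xi =
      [set primal_ode payoff theta g eps alpha beta gamma x xi].
Proof.
move=> x xi rx; apply/seteqP; split=> [[w1 w2] H|_ ->] /=.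
  rewrite /primal_ode; congr pair; apply/mxcolP => p; rewrite mxcolK.
    exact: (H p).1.
  have [_ [z /= Cz <-]] := H p.
  by rewrite (hessian_fiber heps (hreg p) (hg p) (hC p) (rx p) Cz).
move=> p; rewrite /= !mxcolK; split=> //.
exists (gradient (fun y => eps * g p y) (submxcol x p)) => //=.
exact: (mirror_map_gradient heps (hreg p) (hg p) (hC p) (rx p)).
Qed.
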